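(* Let $m$ be a positive integer, let $r\ge0$, let $\alpha>0$, and let $\lambda$ be a nonzero real number. Let $X$ be a Poisson random variable with parameter $\frac{\alpha}{m}$. Then for every integer $n\ge0$, $$D^{(r)}_{m,\lambda}(n,\alpha)=E[(mX+r)_{n,\lambda}]=m^n\sum_{k=0}^nC_k\Big(\frac{r}{m};-\frac{\alpha}{m}\Big)S_{2,\frac{\lambda}{m}}(n,k).$$
   Context: For real $x$ and nonzero real $\mu$, $(x)_{0,\mu}=1$, $(x)_{n,\mu}=x(x-\mu)\cdots(x-(n-1)\mu)$ for $n\ge1$; $(x)_0=1$, $(x)_k=x(x-1)\cdots(x-k+1)$. The degenerate Stirling numbers of the second kind are defined by $(x)_{n,\mu}=\sum_{k=0}^nS_{2,\mu}(n,k)(x)_k$. The Charlier polynomials $C_n(x;\beta)$ are defined by $e^{-\beta t}(1+t)^x=\sum_{n\ge0}C_n(x;\beta)\frac{t^n}{n!}$. The degenerate $r$-Whitney numbers of the second kind $W^{(r)}_{m,\lambda}(n,k)$ are defined by $(mx+r)_{n,\lambda}=\sum_{k=0}^nW^{(r)}_{m,\lambda}(n,k)m^k(x)_k$, and the degenerate $r$-Dowling polynomials by $D^{(r)}_{m,\lambda}(n,x)=\sum_{k=0}^nW^{(r)}_{m,\lambda}(n,k)x^k$; equivalently $e_\lambda^r(t)e^{\frac{x}{m}(e_\lambda^m(t)-1)}=\sum_nD^{(r)}_{m,\lambda}(n,x)\frac{t^n}{n!}$ with $e_\lambda^x(t)=(1+\lambda t)^{x/\lambda}$. *)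

(* Defs.v *)
From HB Require Import structures.
From mathcomp Require Import all_boot all_order all_algebra.
From mathcomp Require Import all_classical all_reals all_analysis.

Set Implicit Arguments.
Unset Strict Implicit.
Unset Printing Implicit Defensive.

Import Order.TTheory GRing.Theory Num.Theory.
Import numFieldNormedType.Exports.

Local Open Scope classical_set_scope.
Local Open Scope ring_scope.

Definition falling {R : realType} (x : R) (n : nat) : R :=
  \prod_(i < n) (x - i%:R).

Definition degenerate_falling {R : realType} (mu x : R) (n : nat) : R :=
  \prod_(i < n) (x - i%:R * mu).

(* The coefficients c_0, ..., c_n of f in the family b_0, ..., b_n. Whenever f
   lies in the span of linearly independent functions b_0, ..., b_n (as in both
   uses below), they exist and are unique; the coefficients of index > n are
   fixed to 0. *)
Definition expansion_coef {R : realType} (n : nat) (b : nat -> R -> R)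
    (f : R -> R) : nat -> R :=
  xget (fun=> 0) [set c : nat -> R |
    (forall x, f x = \sum_(k < n.+1) c k * b k x) /\
    (forall k, (n < k)%N -> c k = 0)].

Definition degenerate_stirling2 {R : realType} (mu : R) (n k : nat) : R :=
  expansion_coef n (fun j x => falling x j)
    (fun x => degenerate_falling mu x n) k.

Definition degenerate_whitney2 {R : realType} (m : nat) (r lambda : R)
    (n k : nat) : R :=
  expansion_coef n (fun j x => m%:R ^+ j * falling x j)
    (fun x => degenerate_falling lambda (m%:R * x + r) n) k.

Definition degenerate_dowling {R : realType} (m : nat) (r lambda : R)
    (n : nat) (x : R) : R :=
  \sum_(k < n.+1) degenerate_whitney2 m r lambda n k * x ^+ k.

(* C_n(x; beta), from the exponential generating function
   e^(- beta t) (1 + t)^x = \sum_n C_n(x; beta) t^n / n!, required for t near 0;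
   this function is analytic at 0, so the sequence exists and is unique. *)
Definition charlier {R : realType} (n : nat) (x beta : R) : R :=
  xget (fun=> 0) [set c : nat -> R |
    \forall t \near (0 : R),
      pseries (fun k => c k / k`!%:R) t @ \oo
        --> expR (- (beta * t)) * (1 + t) `^ x] n.

(* Main.v *)
(* Let c_k be the Poisson(b) mean of (X + s)_k. The Stein-Chen identity
   E[X f(X)] = b E[f(X + 1)] yields c_{k+1} = (s - k + b) c_k + b k c_{k-1}; for
   s = 0 the solution is b^k. Read on the exponential generating function F of
   (c_k), this recurrence is (1 + t) F' = (s + b (1 + t)) F, whose solution with
   F(0) = 1 is e^{bt} (1 + t)^s, so c_k = C_k(s; -b). With b = alpha / m, the two
   sides of the theorem are the means of (mX + r)_{n,lambda} expanded in the
   family m^k (X)_k, and of m^n (X + r/m)_{n,lambda/m} expanded in the family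
   (X + r/m)_k. *)
Require Import Defs.
From HB Require Import structures.
From mathcomp Require Import all_boot all_order all_algebra.
From mathcomp Require Import all_classical all_reals all_analysis.
From mathcomp Require Import measurable_realfun.
From mathcomp Require Import ring lra.

Set Implicit Arguments.
Unset Strict Implicit.
Unset Printing Implicit Defensive.

Import Order.TTheory GRing.Theory Num.Theory.
Import numFieldNormedType.Exports.

Local Open Scope classical_set_scope.
Local Open Scope ring_scope.

(** * Falling factorials and expansions in them *)

Lemma fallingS (R : realType) (x : R) n :
  falling x n.+1 = falling x n * (x - n%:R).
Proof. by rewrite /falling big_ord_recr. Qed.

Lemma fallingS_addr1 (R : realType) (x : R) n :
  falling (x + 1) n.+1 = (x + 1) * falling x n.
Proof.
rewrite /falling big_ord_recl subr0; congr (_ * _); apply: eq_bigr => i _.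
by rewrite lift0 -natr1 opprD addrACA subrr addr0.
Qed.

Lemma falling_addr1 (R : realType) (x : R) n :
  falling (x + 1) n = falling x n + n%:R * falling x n.-1.
Proof.
case: n => [|n]; first by rewrite /falling !big_ord0 mul0r addr0.
by rewrite fallingS_addr1 fallingS /= -natr1; ring.
Qed.

(** At a natural number a zero factor appears before any negative one. This sign lets (X)_k be
    integrated as a nonnegative function. *)
Lemma falling_nat_ge0 (R : realType) k n : 0 <= falling (k%:R : R) n.
Proof.
elim: n k => [|n IHn] [|k]; rewrite ?/falling ?big_ord0 ?ler01 //.
  by rewrite big_ord_recl subrr mul0r.
by rewrite -natr1 [X in 0 <= X]fallingS_addr1 mulr_ge0 ?natr1 ?IHn.
Qed.

Lemma degenerate_falling_scale (R : realType) (a mu x : R) n :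
  degenerate_falling (a * mu) (a * x) n = a ^+ n * degenerate_falling mu x n.
Proof.
rewrite /degenerate_falling -[in a ^+ n](card_ord n) -prodr_const -big_split.
by apply: eq_bigr => i _ /=; ring.
Qed.

(** Existence for both coefficient families: a = m gives the Whitney numbers, a = 1 and r = 0 the
    Stirling numbers. *)
Lemma degenerate_falling_expansion (R : realType) (lambda a r : R) n :
  exists c : nat -> R,
    (forall x, degenerate_falling lambda (a * x + r) n =
       \sum_(k < n.+1) c k * (a ^+ k * falling x k)) /\
    (forall k, (n < k)%N -> c k = 0).
Proof.
elim: n => [|n [c [cE c0]]].
  exists (fun k => (k == 0%N)%:R); split=> [x|[]//].
  by rewrite big_ord1 /degenerate_falling /falling !big_ord0 expr0 !mulr1.
(* The new factor is a x + r - n lambda = a (x - k) + (a k + r - n lambda): on a^k (x)_k the first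
   summand raises k by one, the second keeps it. *)
exists (fun k => (if k is j.+1 then c j else 0) +
                 (a * k%:R + r - n%:R * lambda) * c k); split=> [x|k]; last first.
  by case: k => // k nk; rewrite !c0 ?mulr0 ?addr0 // ltnW.
rewrite /degenerate_falling big_ord_recr /=.
rewrite -/(degenerate_falling lambda (a * x + r) n) cE mulr_suml.
under [RHS]eq_bigr do rewrite mulrDl.
rewrite big_split /= [X in _ = X + _]big_ord_recl mul0r add0r.
rewrite [X in _ = _ + X]big_ord_recr /= c0 // mulr0 mul0r addr0 -big_split.
by apply: eq_bigr => k _ /=; rewrite fallingS exprS; ring.
Qed.

Lemma expansion_coefP (R : realType) n (b : nat -> R -> R) (f : R -> R) :
  (exists c : nat -> R, (forall x, f x = \sum_(k < n.+1) c k * b k x) /\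
     (forall k, (n < k)%N -> c k = 0)) ->
  forall x, f x = \sum_(k < n.+1) expansion_coef n b f k * b k x.
Proof. by move=> fc; have [] := xgetPex (fun=> 0) fc. Qed.

Lemma degenerate_whitney2E (R : realType) m (r lambda : R) n x :
  degenerate_falling lambda (m%:R * x + r) n =
  \sum_(k < n.+1) degenerate_whitney2 m r lambda n k * (m%:R ^+ k * falling x k).
Proof.
apply: (@expansion_coefP _ _ (fun k y => m%:R ^+ k * falling y k)
          (fun y => degenerate_falling lambda (m%:R * y + r) n)).
exact: degenerate_falling_expansion.
Qed.

Lemma degenerate_stirling2E (R : realType) (mu : R) n x :
  degenerate_falling mu x n =
  \sum_(k < n.+1) degenerate_stirling2 mu n k * falling x k.
Proof.
apply: (@expansion_coefP _ _ (fun k y => falling y k)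
          (fun y => degenerate_falling mu y n)).
have [c [cE c0]] := degenerate_falling_expansion mu 1 0 n; exists c.
split=> // y; rewrite -[y in LHS]addr0 -[y in LHS]mul1r cE.
by under eq_bigr do rewrite expr1n mul1r.
Qed.

(** * Poisson means as limits of series *)

(** Encoded as convergence of partial sums, the mean applies to functions of changing sign such as
    (X + s)_k without an integrability argument. *)
Definition poisson_mean (R : realType) (b : R) (f : nat -> R) (l : R) :=
  series (fun k => f k * poisson_pmf b k) @ \oo --> l.

Lemma poisson_mean_scale (R : realType) (b a : R) f l :
  poisson_mean b f l -> poisson_mean b (fun k => a * f k) (a * l).
Proof.
move=> fl; rewrite /poisson_mean.
rewrite (_ : series _ = cst a \* series (fun k => f k * poisson_pmf b k)).
  exact: cvgM (cvg_cst a) fl.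
apply/funext => n; rewrite /series /= mulr_sumr.
by apply: eq_bigr => i _; rewrite mulrA.
Qed.

Arguments poisson_mean_scale {R b} a {f l}.

Lemma poisson_meanD (R : realType) (b : R) f g l l' :
  poisson_mean b f l -> poisson_mean b g l' ->
  poisson_mean b (fun k => f k + g k) (l + l').
Proof.
move=> fl gl; rewrite /poisson_mean.
rewrite (_ : series _ = series (fun k => f k * poisson_pmf b k) \+
                        series (fun k => g k * poisson_pmf b k)).
  exact: cvgD.
apply/funext => n; rewrite /series /= -big_split.
by apply: eq_bigr => i _; rewrite /= mulrDl.
Qed.

Lemma poisson_mean_sum (R : realType) (b : R) n (f : nat -> nat -> R) l :
  (forall j, poisson_mean b (f j) (l j)) ->
  poisson_mean b (fun k => \sum_(j < n) f j k) (\sum_(j < n) l j).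
Proof.
move=> fl; elim: n => [|n IHn].
  rewrite /poisson_mean; under eq_fun do rewrite big_ord0 mul0r.
  rewrite big_ord0; apply: cvg_near_cst; near=> n.
  by rewrite /series /= big1.
rewrite big_ord_recr; under eq_fun do rewrite big_ord_recr.
exact: poisson_meanD.
Unshelve. all: by end_near. Qed.

(** The Poisson weights satisfy (k + 1) p(k + 1) = b p(k), and the term k = 0 vanishes, so the two
    sequences of partial sums agree up to a shift by one. *)
Lemma poisson_mean_stein (R : realType) (b : R) f l : 0 < b ->
  poisson_mean b (fun k => f k.+1) l ->
  poisson_mean b (fun k => k%:R * f k) (b * l).
Proof.
move=> b0 fl; have := poisson_mean_scale b fl.
rewrite /poisson_mean -[X in _ -> X]cvg_shiftS.
suff -> : [sequence series (fun k => k%:R * f k * poisson_pmf b k) n.+1]_n =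
          series (fun k => b * f k.+1 * poisson_pmf b k) by [].
apply/funext => n.
rewrite /series /= [LHS]big_nat_recl // !mul0r add0r.
apply: eq_bigr => i _; rewrite /poisson_pmf b0 factS natrM exprS invfM.
have i0 : i.+1%:R != 0 :> R by rewrite pnatr_eq0.
have f0 : i`!%:R != 0 :> R by rewrite pnatr_eq0 -lt0n fact_gt0.
by field; rewrite f0 nat1r.
Qed.

Lemma poisson_mean1 (R : realType) (b : R) : 0 < b -> poisson_mean b (fun=> 1) 1.
Proof.
move=> b0; rewrite /poisson_mean -[X in _ --> X](expRxMexpNx_1 b) mulrC.
rewrite (_ : series _ = cst (expR (- b)) \* series (exp_coeff b)).
  exact: cvgM (cvg_cst _) (is_cvg_series_exp_coeff b : _ @ \oo --> expR b).
apply/funext => n; rewrite /series /= mulr_sumr.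
by apply: eq_bigr => i _; rewrite /poisson_pmf b0 mul1r mulrC /exp_coeff.
Qed.

(** The c_k of the Stein-Chen recurrence, defined by that recurrence alone so that both the Poisson
    series and the generating function can be compared with it. The inner match drops c_{j-1} at j =
    0. *)
Fixpoint poisson_falling_mean {R : realType} (b s : R) (k : nat) : R :=
  if k isn't j.+1 then 1 else
    (s - j%:R + b) * poisson_falling_mean b s j +
    (if j is i.+1 then b * j%:R * poisson_falling_mean b s i else 0).

Lemma poisson_falling_meanS (R : realType) (b s : R) k :
  poisson_falling_mean b s k.+1 =
  (s - k%:R + b) * poisson_falling_mean b s k +
  b * k%:R * poisson_falling_mean b s k.-1.
Proof. by case: k => [|k] //=; rewrite mulr0 mul0r. Qed.

Lemma poisson_falling_mean0r (R : realType) (b : R) k :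
  poisson_falling_mean b 0 k = b ^+ k.
Proof.
elim/ltn_ind: k => -[_|k IHk]; first by rewrite expr0.
rewrite poisson_falling_meanS IHk //.
case: k IHk => [|k] IHk; first by rewrite /= expr0 expr1; ring.
by rewrite /= IHk // !exprS; ring.
Qed.

(** Write the last factor of (X + s)_{k+1} as (s - k) + X. Stein-Chen turns the X part into b times
    the mean of (X + 1 + s)_k, and (y + 1)_k = (y)_k + k (y)_{k-1} reduces this to c_k and
    c_{k-1}. *)
Lemma poisson_mean_falling (R : realType) (b s : R) k : 0 < b ->
  poisson_mean b (fun i => falling (i%:R + s) k) (poisson_falling_mean b s k).
Proof.
move=> b0; elim/ltn_ind: k => -[_|k IHk].
  rewrite [X in poisson_mean _ X](_ : _ = fun=> 1); first exact: poisson_mean1.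
  by apply/funext => i; rewrite /falling big_ord0.
rewrite poisson_falling_meanS.
have IH : poisson_mean b (fun i => falling (i.+1%:R + s) k)
    (poisson_falling_mean b s k + k%:R * poisson_falling_mean b s k.-1).
  under eq_fun do rewrite -natr1 addrAC falling_addr1.
  apply: poisson_meanD; first exact: IHk.
  apply: poisson_mean_scale; apply: IHk.
  by rewrite ltnS leq_pred.
have := poisson_meanD (poisson_mean_scale (s - k%:R) (IHk k (ltnSn k)))
  (@poisson_mean_stein _ _ (fun i => falling (i%:R + s) k) _ b0 IH).
rewrite (_ : (fun i => _) = (fun i => falling (i%:R + s) k.+1)); last first.
  by apply/funext => i; rewrite fallingS; ring.
by congr (poisson_mean _ _ _); ring.
Qed.

(** * From Poisson series to expectations *)

(** The integral moves to the law of X on [nat]; nonnegativity of g makes it countably additive over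
    singletons, which yields the series. *)
Lemma integral_poisson (R : realType) d (T : measurableType d)
    (P : probability T R) (X : {RV P >-> nat}) (b : R) (g : nat -> R) (l : R) :
  (forall k, distribution P X [set k] = (poisson_pmf b k)%:E) ->
  (forall k, 0 <= g k) -> poisson_mean b g l ->
  (\int[P]_w (g (X w))%:E = l%:E)%E.
Proof.
move=> hX g0 gl.
have -> : (\int[P]_w (g (X w))%:E = \int[distribution P X]_k (g k)%:E)%E.
  by rewrite (ge0_integral_distribution X (f := EFin \o g)).
have -> : [set: nat] = \bigcup_k [set k].
  by apply/seteqP; split=> // k _; exists k.
rewrite ge0_integral_bigcup //; first last.
- by move=> i j _ _ [x [-> ->]].
- by move=> k _; rewrite lee_fin.
have int1 k : (\int[distribution P X]_(x in [set k]) (g x)%:E =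
    (g k * poisson_pmf b k)%:E)%E.
  rewrite (eq_integral (cst (g k)%:E)).
    by rewrite integral_cst // EFinM -hX.
  by move=> x; rewrite inE => ->.
under eq_eseriesr do rewrite int1.
apply/cvg_lim => //.
rewrite (_ : (fun n => _) = EFin \o series (fun k => g k * poisson_pmf b k)).
  by apply: cvg_EFin => //; exact: nearW.
by apply/funext => n; rewrite /series /= sumEFin.
Qed.

(** The c k may have any sign, so linearity rests on integrability of each (X)_k, which is
    nonnegative with finite integral b^k. *)
Lemma expectation_poisson_falling (R : realType) d (T : measurableType d)
    (P : probability T R) (X : {RV P >-> nat}) (b : R) n (c : nat -> R) : 0 < b ->
  (forall k, distribution P X [set k] = (poisson_pmf b k)%:E) ->
  ('E_P[fun w => (\sum_(k < n) c k * falling (X w)%:R k)%R] =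
   (\sum_(k < n) c k * b ^+ k)%R%:E)%E.
Proof.
move=> b0 hX.
have int_falling k : (\int[P]_w (falling (X w)%:R k)%:E = (b ^+ k)%:E)%E.
  apply: (integral_poisson (g := fun i => falling i%:R k) hX).
    by move=> i; exact: falling_nat_ge0.
  rewrite -poisson_falling_mean0r.
  by under eq_fun do rewrite -[_%:R]addr0; exact: poisson_mean_falling.
have Lfalling k : (fun w => falling (X w)%:R k) \in Lfun P 1.
  apply/Lfun1_integrable/integrableP; split.
    apply/measurable_EFinP.
    exact: (measurableT_comp (f := fun i : nat => falling i%:R k)).
  under eq_integral do rewrite /= ger0_norm ?falling_nat_ge0 //.
  by rewrite int_falling ltry.
rewrite unlock.
under eq_integral do rewrite -sumEFin.
rewrite integral_sum //.
  rewrite -sumEFin; apply: eq_bigr => k _.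
  under eq_integral do rewrite EFinM.
  rewrite integralZl //; last exact/Lfun1_integrable.
  by rewrite int_falling.
move=> k; under eq_fun do rewrite EFinM.
by apply: integrableZl => //; exact/Lfun1_integrable.
Qed.

(** * Power series with geometrically bounded coefficients, and their uniqueness near 0 *)

Lemma is_cvg_pseries_geometric (R : realType) (a : nat -> R) (B M x : R) :
  0 < M -> (forall i, `|a i| <= B * M ^+ i) -> `|x| < M^-1 ->
  cvgn (pseries a x).
Proof.
move=> M0 aB xM; apply: normed_cvg.
apply: (@series_le_cvg _ _ (geometric B (M * `|x|))) => [n|n|n|] //=.
- apply: le_trans (_ : 0 <= `|a n| * `|x| ^+ n) _.
    by rewrite mulr_ge0 // exprn_ge0.
  by rewrite exprMn mulrA ler_wpM2r // exprn_ge0.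
- by rewrite normrM normrX exprMn mulrA ler_wpM2r // exprn_ge0.
apply: is_cvg_geometric_series.
by rewrite normrM normr_id (gtr0_norm M0) mulrC -ltr_pdivlMr // div1r.
Qed.

(** Since i + 1 <= 2^i, each termwise differentiation at most doubles the rate M. *)
Lemma pseries_diffs_geometric (R : realType) (a : nat -> R) (B M : R) :
  0 < M -> (forall i, `|a i| <= B * M ^+ i) ->
  forall i, `|pseries_diffs a i| <= B * M * (2 * M) ^+ i.
Proof.
move=> M0 aB i; rewrite /pseries_diffs normrM normr_nat.
have -> : B * M * (2 * M) ^+ i = 2 ^+ i * (B * M ^+ i.+1).
  by rewrite exprMn exprS; ring.
apply: ler_pM => //; rewrite -natrX ler_nat; exact: ltn_expl.
Qed.

Lemma is_derive_pseries_geometric (R : realType) (a : nat -> R) (B M x : R) :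
  0 < M -> (forall i, `|a i| <= B * M ^+ i) -> `|x| < (8 * M)^-1 ->
  is_derive x 1 (fun t => limn (pseries a t))
    (limn (pseries (pseries_diffs a) x)).
Proof.
move=> M0 aB xM.
have M20 : 0 < 2 * M by rewrite mulr_gt0.
have M40 : 0 < 2 * (2 * M) by rewrite mulr_gt0.
have aB1 := pseries_diffs_geometric M0 aB.
have aB2 := pseries_diffs_geometric M20 aB1.
have K0 : 0 < (8 * M)^-1 by rewrite invr_gt0 mulr_gt0.
(* The series and its first two derived series have rates M, 2M and 4M, so all three converge at
   1/(8M), strictly beyond |x|. *)
apply: (@pseries_snd_diffs _ _ (8 * M)^-1); last by rewrite (gtr0_norm K0).
- apply: is_cvg_pseries_geometric aB _ => //.
  rewrite (gtr0_norm K0) ltf_pV2 ?posrE ?mulr_gt0 //; lra.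
- apply: is_cvg_pseries_geometric aB1 _ => //.
  rewrite (gtr0_norm K0) ltf_pV2 ?posrE ?mulr_gt0 //; lra.
- apply: is_cvg_pseries_geometric aB2 _ => //.
  rewrite (gtr0_norm K0) ltf_pV2 ?posrE ?mulr_gt0 //; lra.
Qed.

(** The terms of a convergent series are bounded, so |a i| |x|^i stays below a constant and the rate
    is 1/|x|. *)
Lemma pseries_cvg_geometric (R : realType) (a : nat -> R) (x : R) :
  x != 0 -> cvgn (pseries a x) ->
  exists B M, 0 < M /\ forall i, `|a i| <= B * M ^+ i.
Proof.
move=> x0 /cvg_series_bounded[K [_ Kf]].
exists (K + 1), `|x|^-1; split; first by rewrite invr_gt0 normr_gt0.
move=> i; rewrite exprVn ler_pdivlMr ?exprn_gt0 ?normr_gt0 //.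
by rewrite -normrX -normrM; apply: (Kf (K + 1)) => //; rewrite ltrDl.
Qed.

Lemma pseries_at0 (R : realType) (a : nat -> R) : pseries a 0 @ \oo --> a 0%N.
Proof.
rewrite -cvg_shiftS; apply: cvg_near_cst; apply: nearW => n.
rewrite /pseries /series /= big_nat_recl // expr0 mulr1 big1 ?addr0 // => i _.
by rewrite expr0n mulr0.
Qed.

Lemma near0_normP (R : realType) (Q : R -> Prop) :
  (\forall t \near (0 : R), Q t) <->
  exists2 e : R, 0 < e & forall t, `|t| < e -> Q t.
Proof.
split=> [/nbhs_ballP[e /= e0 eQ]|[e e0 eQ]].
  by exists e => // t te; apply: eQ; rewrite /ball /= sub0r normrN.
apply/nbhs_ballP; exists e => //= t.
by rewrite /ball /= sub0r normrN => /eQ.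
Qed.

(** The value at 0 gives a 0 = 0. The derived series also vanishes near 0, with coefficients (k + 1)
    a (k + 1), so induction on k, for all a at once, applies to it. *)
Lemma pseries_near0_eq0 (R : realType) (a : nat -> R) :
  (\forall t \near (0 : R), pseries a t @ \oo --> (0 : R)) -> forall k, a k = 0.
Proof.
move=> a0 k; elim: k a a0 => [|k IHk] a a0.
  have := nbhs_singleton a0; apply: cvg_unique => //; exact: pseries_at0.
suff /IHk : \forall t \near (0 : R),
    pseries (pseries_diffs a) t @ \oo --> (0 : R).
  by move=> /eqP; rewrite /pseries_diffs mulf_eq0 pnatr_eq0 => /eqP.
move/near0_normP: a0 => [e e0 ea].
have [B [M [M0 aB]]] : exists B M, 0 < M /\ forall i, `|a i| <= B * M ^+ i.
  have e20 : 0 < e / 2 by rewrite divr_gt0.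
  apply: (@pseries_cvg_geometric _ _ (e / 2)); first by rewrite gt_eqF.
  by apply/cvg_ex; exists 0; apply: ea; rewrite gtr0_norm //; lra.
(* Below e the sum is zero around x; below 1/(8M) termwise differentiation is valid. *)
apply/near0_normP; exists (Num.min e (8 * M)^-1).
  by rewrite lt_min e0 invr_gt0 mulr_gt0.
move=> x; rewrite lt_min => /andP[xe xM].
have dF := is_derive_pseries_geometric M0 aB xM.
have dF0 : is_derive x 1 (fun t => limn (pseries a t)) 0.
  apply: (@near_eq_is_derive _ _ _ (cst 0)).
  near=> t; apply/esym/cvg_lim => //; apply: ea.
  near: t; apply: (cvgr_norm_lt (FF := nbhs_filter x) (f := id)) xe.
  exact: cvg_id.
(* Both expressions are the derivative of the sum at x. As [limn] alone does not assert convergence,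
   convergence of the derived series is then proved separately. *)
have <- : limn (pseries (pseries_diffs a) x) = 0.
  by rewrite -(@derive_val _ _ _ _ _ _ _ dF) (@derive_val _ _ _ _ _ _ _ dF0).
apply: (is_cvg_pseries_geometric _ (pseries_diffs_geometric M0 aB)).
  by rewrite mulr_gt0.
apply: lt_le_trans xM _; rewrite lef_pV2 ?posrE ?mulr_gt0 //; lra.
Unshelve. all: by end_near. Qed.

Lemma pseries_near0_inj (R : realType) (a b : nat -> R) (g : R -> R) :
  (\forall t \near (0 : R), pseries a t @ \oo --> g t) ->
  (\forall t \near (0 : R), pseries b t @ \oo --> g t) -> forall k, a k = b k.
Proof.
move=> ag bg k; apply/eqP; rewrite -subr_eq0; apply/eqP.
apply: (@pseries_near0_eq0 _ (fun i => a i - b i)).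
near=> t; rewrite -(subrr (g t)).
rewrite (_ : pseries _ t = pseries a t \- pseries b t).
  by apply: cvgB; near: t.
apply/funext => n; rewrite /pseries /series /= -sumrB.
by apply: eq_bigr => i _; rewrite mulrBl.
Unshelve. all: by end_near. Qed.

(** * The generating function of the c_k and the Charlier polynomials *)

Lemma poisson_falling_mean_geometric (R : realType) (b s : R) k :
  `|poisson_falling_mean b s k / k`!%:R| <= 1 * (1 + 2 * `|b| + `|s|) ^+ k.
Proof.
(* With a_k = c_k / k!, the recurrence is (k + 1) a_{k+1} = (s - k + b) a_k + b a_{k-1}. The
   induction closes because |s| + k + 2 |b| <= (k + 1) M. *)
set M := 1 + _ + _; have b0 := normr_ge0 b; have s0 := normr_ge0 s.
have M1 : 1 <= M by rewrite /M; lra.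
rewrite mul1r; elim/ltn_ind: k => -[_|k IHk]; first by rewrite divr1 normr1.
have k0 : 0 <= k%:R :> R by [].
rewrite poisson_falling_meanS factS natrM invfM mulrA mulrAC.
rewrite normrM normfV normr_nat ler_pdivrMr ?ltr0n // mulrDl.
have h1 : `|(s - k%:R + b) * poisson_falling_mean b s k / k`!%:R| <=
    (`|s| + k%:R + `|b|) * M ^+ k.
  rewrite -mulrA normrM ler_pM ?IHk //.
  apply: le_trans (ler_normD _ _) _; rewrite lerD2r.
  by apply: le_trans (ler_normB _ _) _; rewrite normr_nat.
have h2 : `|b * k%:R * poisson_falling_mean b s k.-1 / k`!%:R| <= `|b| * M ^+ k.
  case: k IHk {h1 k0} => [|k] IHk.
    by rewrite mulr0 !mul0r normr0 mulr_ge0 // exprn_ge0 //; lra.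
  have -> : b * k.+1%:R * poisson_falling_mean b s k.+1.-1 / k.+1`!%:R =
      b * (poisson_falling_mean b s k / k`!%:R).
    have i0 : k.+1%:R != 0 :> R by rewrite pnatr_eq0.
    have f0 : k`!%:R != 0 :> R by rewrite pnatr_eq0 -lt0n fact_gt0.
    by rewrite factS natrM /=; field; rewrite f0 nat1r.
  rewrite normrM ler_wpM2l //; apply: le_trans (IHk k _) _ => //.
  by rewrite exprS ler_peMl // exprn_ge0 //; lra.
apply: le_trans (ler_normD _ _) _; apply: le_trans (lerD h1 h2) _.
rewrite -mulrDl exprS mulrAC ler_wpM2r //; first by rewrite exprn_ge0 //; lra.
rewrite -natr1 /M; nra.
Qed.

(* The coefficientwise form of (1 + t) F' = (s + b (1 + t)) F. *)
Lemma pseries_poisson_falling_mean_rec (R : realType) (b s t : R) n :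
  let a k := poisson_falling_mean b s k / k`!%:R in
  pseries (pseries_diffs a) t n.+1 =
  (s + b) * pseries a t n.+1 - t * pseries (pseries_diffs a) t n
  + b * t * pseries a t n.
Proof.
move=> a; rewrite /pseries /series /=.
(* The terms - k a_k sum to - t F' and the terms b a_{k-1} to b t F. The factor t shifts the index,
   so these two sums stop one term earlier and the identity is exact on partial sums. *)
have recE k : pseries_diffs a k =
    (s - k%:R + b) * a k + (if k is j.+1 then b * a j else 0).
  rewrite /pseries_diffs /a factS natrM poisson_falling_meanS.
  have i0 : k.+1%:R != 0 :> R by rewrite pnatr_eq0.
  have f0 : k`!%:R != 0 :> R by rewrite pnatr_eq0 -lt0n fact_gt0.
  case: k i0 f0 => [|k] i0 f0; first by rewrite fact0; field.
  have j0 : k`!%:R != 0 :> R by rewrite pnatr_eq0 -lt0n fact_gt0.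
  have l0 : k.+1%:R != 0 :> R by rewrite pnatr_eq0.
  by rewrite factS natrM /=; field; rewrite j0 nat1r l0 /= -natrD pnatr_eq0.
elim: n => [|n IHn].
  by rewrite !big_nat1 !big_geq // recE; ring.
have sumS (f : nat -> R) m : \sum_(0 <= k < m.+1) f k * t ^+ k =
    \sum_(0 <= k < m) f k * t ^+ k + f m * t ^+ m by rewrite big_nat_recr.
rewrite [LHS]sumS [X in X + _ = _]IHn recE.
rewrite (sumS a n.+1) (sumS (pseries_diffs a) n) (sumS a n).
by rewrite /pseries_diffs !exprS; ring.
Qed.

(** The recurrence on partial sums passes to the limit and gives the differential equation for the
    sum F. Multiplying F by the inverse of the expected solution gives a function G with zero
    derivative and G(0) = 1. *)
Lemma pseries_poisson_falling_mean (R : realType) (b s : R) :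
  \forall t \near (0 : R),
    pseries (fun k => poisson_falling_mean b s k / k`!%:R) t @ \oo
      --> expR (- (- b * t)) * (1 + t) `^ s.
Proof.
pose a k := poisson_falling_mean b s k / k`!%:R; rewrite -/a.
set M := 1 + 2 * `|b| + `|s|.
have M1 : 1 <= M by have := normr_ge0 b; have := normr_ge0 s; rewrite /M; lra.
have M0 : 0 < M by lra.
have aM : forall k, `|a k| <= 1 * M ^+ k by exact: poisson_falling_mean_geometric.
have daM := pseries_diffs_geometric M0 aM.
have e0 : 0 < (8 * M)^-1 by rewrite invr_gt0 mulr_gt0.
(* This radius allows termwise differentiation of F and, as M >= 1, is below 1, so that 1 + t > 0
   and the real power is differentiable. *)
apply/near0_normP; exists (8 * M)^-1 => // t tM; rewrite mulNr opprK.
have cvg_a x : `|x| < (8 * M)^-1 -> cvgn (pseries a x).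
  move=> xM; apply: (is_cvg_pseries_geometric M0 aM).
  apply: lt_le_trans xM _; rewrite lef_pV2 ?posrE ?mulr_gt0 //; lra.
have cvg_da x : `|x| < (8 * M)^-1 -> cvgn (pseries (pseries_diffs a) x).
  move=> xM; apply: (is_cvg_pseries_geometric _ daM); first by rewrite mulr_gt0.
  apply: lt_le_trans xM _; rewrite lef_pV2 ?posrE ?mulr_gt0 //; lra.
have e1 : (8 * M)^-1 < 1 by rewrite invf_lt1 ?mulr_gt0 //; lra.
have pos1D x : `|x| < (8 * M)^-1 -> 0 < 1 + x.
  by rewrite ltr_norml => /andP[]; lra.
pose F (x : R) : R := limn (pseries a x).
pose dF (x : R) : R := limn (pseries (pseries_diffs a) x).
have ode x : `|x| < (8 * M)^-1 -> (1 + x) * dF x = (s + b * (1 + x)) * F x.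
  move=> xM; have ca := cvg_a x xM; have cda := cvg_da x xM.
  have : dF x = (s + b) * F x - x * dF x + b * x * F x.
    have lS : [sequence pseries (pseries_diffs a) x n.+1]_n @ \oo --> dF x.
      by rewrite cvg_shiftS.
    have aS : [sequence pseries a x n.+1]_n @ \oo --> F x by rewrite cvg_shiftS.
    apply: (cvg_unique _ lS); first exact: norm_hausdorff.
    rewrite (_ : mk_sequence _ = fun n => (s + b) * pseries a x n.+1 -
      x * pseries (pseries_diffs a) x n + b * x * pseries a x n).
      apply: cvgD; last exact: cvgM (cvg_cst _) ca.
      apply: cvgB; first exact: cvgM (cvg_cst _) aS.
      exact: cvgM (cvg_cst _) cda.
    by apply/funext => n; exact: pseries_poisson_falling_mean_rec.
  by move=> h; nra.
have dFx (x : R) : `|x| < (8 * M)^-1 -> is_derive x (1 : R) F (dF x).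
  exact: is_derive_pseries_geometric.
pose G : R -> R := F * (expR \o (fun x => - b * x)) *
    ((fun x => x `^ (- s)) \o (fun x => 1 + x)).
have dG (x : R) : `|x| < (8 * M)^-1 -> is_derive x (1 : R) G 0.
  move=> xM; have x1 := pos1D x xM; have := dFx x xM => dFx'.
  have dlin : is_derive x 1 (fun y : R => - b * y) (- b).
    by apply: is_derive_eq; rewrite /GRing.scale /= mulr1.
  have dadd : is_derive x 1 (fun y : R => 1 + y) 1.
    by apply: is_derive_eq; rewrite add0r mulr1.
  have dexp : is_derive x 1 (expR \o (fun y : R => - b * y))
      (expR (- b * x) * - b).
    exact: is_derive1_comp.
  have dpow : is_derive x 1 ((fun y => y `^ (- s)) \o (fun y : R => 1 + y))
      (- s * (1 + x) `^ (- s - 1) * 1).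
    have dp := @is_derive1_powR _ (- s) _ x1.
    exact: (@is_derive1_comp _ (fun y => y `^ (- s)) (fun y => 1 + y)).
  have dFE : dF x = (s + b * (1 + x)) * F x / (1 + x).
    by rewrite -ode // mulrAC divff ?mul1r // gt_eqF.
  apply: is_derive_eq; rewrite dFE /GRing.scale /=.
  (* The power with exponent - s - 1 becomes (1 + x)^(-s) / (1 + x), so that a single real power
     remains, treated by [field] as an atom. *)
  rewrite powRB; last by rewrite (gt_eqF x1) implybT.
  rewrite powRr1 ?ltW //.
  change (F x * expR (- b * x) * (- s * ((1 + x) `^ (- s) / (1 + x)) * 1) +
    (1 + x) `^ (- s) * (F x * (expR (- b * x) * - b) +
      expR (- b * x) * ((s + b * (1 + x)) * F x / (1 + x))) = 0).
  by field; rewrite gt_eqF.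
have GE x : G x = F x * expR (- b * x) * (1 + x) `^ (- s) by [].
have G0 : G 0 = 1.
  rewrite GE mulr0 expR0 addr0 powR1 !mulr1.
  have -> : F 0 = a 0%N by apply/cvg_lim => //; exact: pseries_at0.
  by rewrite /a /= fact0 divr1.
have cstG u v : `|u| < (8 * M)^-1 -> `|v| < (8 * M)^-1 -> u <= v -> G u = G v.
  move=> uM vM uv.
  have dGuv x : x \in `[u, v]%R -> is_derive x (1 : R) G 0.
    rewrite in_itv /= => /andP[ux xv]; apply: dG.
    by move: uM vM; rewrite !ltr_norml => /andP[? ?] /andP[? ?]; apply/andP; lra.
  have cG : {within `[u, v], continuous G}.
    apply: derivable_within_continuous => x xuv.
    exact: (@ex_derive _ _ _ _ _ _ _ (dGuv x xuv)).
  have dG0 x : x \in `]u, v[%R -> is_derive x (1 : R) G 0.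
    by move=> xuv; apply: dGuv; exact: subset_itv_oo_cc xuv.
  have [c _] := @MVT_segment _ G (fun=> 0) _ _ uv dG0 cG.
  by rewrite mul0r => /eqP; rewrite subr_eq0 => /eqP.
have Gt : G t = 1.
  have z : `|0 : R| < (8 * M)^-1 by rewrite normr0.
  rewrite -G0; have [t0|/ltW t0] := leP t 0; first exact: cstG.
  by apply/esym; exact: cstG.
have -> : expR (b * t) * (1 + t) `^ s = F t.
  move: Gt; rewrite GE powRN mulNr expRN.
  have p0 : (1 + t) `^ s != 0 by rewrite gt_eqF // powR_gt0 // pos1D.
  have q0 : expR (b * t) != 0 by rewrite gt_eqF // expR_gt0.
  by move=> h; rewrite -[LHS]mulr1 -[X in _ * X = _]h; field; rewrite p0 q0.
exact: cvg_a.
Qed.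

(** The c_k witness that the defining set of [charlier] is nonempty, so [xget] returns a member of
    it; two coefficient sequences with the same sum near 0 coincide, and k! cancels. *)
Lemma charlierE (R : realType) (b s : R) k :
  charlier k s (- b) = poisson_falling_mean b s k.
Proof.
have fact_neq0 : k`!%:R != 0 :> R by rewrite pnatr_eq0 -lt0n fact_gt0.
apply: (divIf fact_neq0).
have ex_egf : exists c : nat -> R, \forall t \near (0 : R),
    pseries (fun j => c j / j`!%:R) t @ \oo --> expR (- (- b * t)) * (1 + t) `^ s.
  by exists (poisson_falling_mean b s); exact: pseries_poisson_falling_mean.
have charlier_egf := xgetPex (fun=> 0) ex_egf.
exact: (@pseries_near0_inj _ (fun j => charlier j s (- b) / j`!%:R)
  (fun j => poisson_falling_mean b s j / j`!%:R) _ charlier_egf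
  (pseries_poisson_falling_mean b s) k).
Qed.

(** * Two evaluations of the mean of (mX + r)_{n,lambda} *)

Theorem theorem11 (R : realType) (d : measure_display) (T : measurableType d)
    (P : probability T R) (m : nat) (r alpha lambda : R) (X : {RV P >-> nat})
    (hm : (0 < m)%N) (hr : 0 <= r) (halpha : 0 < alpha) (hlambda : lambda != 0)
    (hX : forall k : nat,
        distribution P X [set k] = (poisson_pmf (alpha / m%:R) k)%:E)
    (n : nat) :
  ((degenerate_dowling m r lambda n alpha)%:E =
     'E_P[fun w => degenerate_falling lambda (m%:R * (X w)%:R + r) n])%E /\
  ('E_P[fun w => degenerate_falling lambda (m%:R * (X w)%:R + r) n] =
     (m%:R ^+ n * \sum_(k < n.+1) charlier k (r / m%:R) (- (alpha / m%:R)) *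
        degenerate_stirling2 (lambda / m%:R) n k)%R%:E)%E.
Proof.
have m0 : m%:R != 0 :> R by rewrite pnatr_eq0 -lt0n.
have b0 : 0 < alpha / m%:R by rewrite divr_gt0 // ltr0n.
set b := alpha / m%:R in hX b0 *.
(* Since b = alpha / m, the factor m^k of the Whitney expansion and the mean b^k of (X)_k combine to
   alpha^k. *)
have dowlingE : \sum_(k < n.+1)
    degenerate_whitney2 m r lambda n k * m%:R ^+ k * b ^+ k =
    degenerate_dowling m r lambda n alpha.
  apply: eq_bigr => k _.
  by rewrite -mulrA -exprMn /b mulrCA divff ?mulr1.
have -> : ('E_P[fun w => degenerate_falling lambda (m%:R * (X w)%:R + r) n] =
    (degenerate_dowling m r lambda n alpha)%:E)%E.
  rewrite -dowlingE -(expectation_poisson_falling n.+1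
    (fun k => degenerate_whitney2 m r lambda n k * m%:R ^+ k) b0 hX).
  congr expectation; apply/funext => w; rewrite degenerate_whitney2E.
  by apply: eq_bigr => k _; rewrite mulrA.
split=> //; congr EFin.
(* For the second equality the values (i + r/m)_k may be negative, so the comparison is made on
   series: both sides are limits of the same Poisson series. *)
have mean_dowling : poisson_mean b
    (fun i => degenerate_falling lambda (m%:R * i%:R + r) n)
    (degenerate_dowling m r lambda n alpha).
  rewrite -dowlingE; under eq_fun do rewrite degenerate_whitney2E.
  apply: (@poisson_mean_sum _ _ _
    (fun k i => degenerate_whitney2 m r lambda n k * (m%:R ^+ k * falling i%:R k))
    (fun k => degenerate_whitney2 m r lambda n k * m%:R ^+ k * b ^+ k)) => k.
  under eq_fun do rewrite mulrA -[X in falling X _]addr0.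
  rewrite -(poisson_falling_mean0r b).
  by apply: poisson_mean_scale; exact: poisson_mean_falling.
suff : poisson_mean b (fun i => degenerate_falling lambda (m%:R * i%:R + r) n)
    (m%:R ^+ n * \sum_(k < n.+1) charlier k (r / m%:R) (- b) *
       degenerate_stirling2 (lambda / m%:R) n k).
  by apply: cvg_unique mean_dowling; exact: norm_hausdorff.
(* Each of the n factors yields one m, from m i + r = m (i + r/m) and lambda = m (lambda/m). *)
have -> : (fun i => degenerate_falling lambda (m%:R * i%:R + r) n) =
    (fun i : nat => m%:R ^+ n * \sum_(k < n.+1)
       degenerate_stirling2 (lambda / m%:R) n k * falling (i%:R + r / m%:R) k).
  apply/funext => i; rewrite -degenerate_stirling2E -degenerate_falling_scale.
  by congr degenerate_falling; field.
apply: poisson_mean_scale.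
under eq_bigr do rewrite charlierE mulrC.
apply: (@poisson_mean_sum _ _ _
  (fun k i => degenerate_stirling2 (lambda / m%:R) n k *
    falling (i%:R + r / m%:R) k)
  (fun k => degenerate_stirling2 (lambda / m%:R) n k *
    poisson_falling_mean b (r / m%:R) k)) => k.
by apply: poisson_mean_scale; exact: poisson_mean_falling.
Qed.
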